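(* For every integer $n\geq 6$, the set $\Sigma_{n,4}$ contains a form that is positive definite and noncoercive.
   Context: A form is a homogeneous polynomial; all polynomials are taken to be forms. $\Sigma_{n,d}$ ($d$ even) denotes the set of all forms $f\in\mathbb{R}[x_1,\ldots,x_n]$ of degree $d$ that are sums of squares, i.e. for which there exist $p_1,\ldots,p_r\in\mathbb{R}[x_1,\ldots,x_n]$ with $f=\sum_{j=1}^r p_j^2$. A form $f$ is positive definite if $f(\mathbf{a})>0$ for all $\mathbf{a}\in\mathbb{R}^n\setminus\{\mathbf{0}\}$. A sum of squares $f\in\mathbb{R}[x_1,\ldots,x_n]$ is called noncoercive if for every representation $f=\sum_{j=1}^r p_j^2$ with $p_1,\ldots,p_r\in\mathbb{R}[x_1,\ldots,x_n]$ the system $p_1=\cdots=p_r=0$ has a solution $\mathbf{a}\in\mathbb{C}^n\setminus\{\mathbf{0}\}$. *)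

(* Defs.v *)
From HB Require Import structures.
From mathcomp Require Import all_boot all_order all_algebra.
From mathcomp Require Import reals.
From mathcomp Require Import complex mpoly.

Set Implicit Arguments.
Unset Strict Implicit.
Unset Printing Implicit Defensive.

Import Order.TTheory GRing.Theory Num.Theory.
Local Open Scope ring_scope.

Section Forms.
Variables (R : realType) (n : nat).
Implicit Types (f : {mpoly R[n]}) (ps : seq {mpoly R[n]}).

(* The squared polynomials are arbitrary; when f is a form of degree 2k, the
   real coefficients force each of them to be 0 or a form of degree k. *)
Definition sos_representation f ps : Prop := f = \sum_(p <- ps) p ^+ 2.

Definition sum_of_squares f : Prop := exists ps, sos_representation f ps.

(* Membership in Sigma_{n,d}. *)
Definition Sigma (d : nat) f : Prop := f \is d.-homog /\ sum_of_squares f.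

Definition positive_definite f : Prop :=
  forall a : 'rV[R]_n, a != 0 -> 0 < f.@[a 0].

Definition common_complex_zero ps (a : 'rV[R[i]]_n) : Prop :=
  forall p, p \in ps -> (map_mpoly (real_complex R) p).@[a 0] = 0.

Definition noncoercive f : Prop :=
  sum_of_squares f /\
  forall ps, sos_representation f ps ->
    exists2 a : 'rV[R[i]]_n, a != 0 & common_complex_zero ps a.

End Forms.

(* Main.v *)
Require Import Defs.
From mathcomp Require Import all_boot all_order all_algebra.
From mathcomp Require Import reals.
From mathcomp Require Import complex mpoly.
From mathcomp Require Import ring lra.

(** The form is obtained from a quadratic form in five nonnegative quantities
    [y_0, ..., y_4], placed cyclically on the vertices of a pentagon:

      (y_0 - y_1 + y_2 - y_3)^2 + (3 y_0 - y_1 - y_2 + 3 y_3 - y_4)^2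
        + (the sum of y_i y_j over the five diagonals of the pentagon),

    by substituting [y_c = x_c^2] for [c < 4] and
    [y_4 = x_4^2 + x_5^2 + ... + x_(n-1)^2].  Every [y_c] is a sum of squares,
    so the result is a sum of squares of degree 4.

    Positive definiteness: if the value is 0 at a nonnegative [y], then the
    support of [y] contains no diagonal, hence lies in an edge of the pentagon;
    on each edge the two linear forms vanish only at 0 among nonnegative vectors
    ([pentagon_gt0]).

    Noncoercivity: the point [z = e_4 + i e_5] satisfies [z_4^2 + z_5^2 = 0], so
    all [y_c] vanish there, and it is shown to be a zero of every polynomial of
    every representation.  These polynomials are quadratic forms [p]
    ([sos_homog]).  Let [D] be the matrix of the quadratic form

      (a_0+a_1+a_4+a_5)^2 + (a_1+a_2-a_4-a_5)^2 + (a_2+a_3+a_4+a_5)^2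
        + (a_4-a_5)^2.

    It is positive semidefinite, it has nonnegative entries, and [D i j = 0] when
    [ij] is a diagonal of the pentagon (4 and 5 both standing for the last
    vertex).  Consider the linear functional on quartics that sends
    [x_i^2 x_j^2] with [i, j <= 5] to [D i j] and all other monomials to 0, and a
    quadratic form [p] with coefficient [a_i] at [x_i^2] and [c_ij] at
    [x_i x_j].  Its value at [p^2] is the above quadratic form at [a] plus the
    sum of [D i j * c_ij^2] over [i < j], so it is at least
    [(a_4 - a_5)^2 + c_45^2] ([dualFunctional_sqr]).  On the other hand it kills
    the given form ([dualFunctional_pentagonForm]): the products over diagonals
    because of the zeros of [D], and the two squares because their coefficient
    vectors, with the coefficient of [y_4] repeated, lie in the kernel of [D].
    The values at the squares [p^2] are nonnegative with sum 0, hence every [p] of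
    a representation has [a_4 = a_5] and [c_45 = 0], which says that
    [p(z) = a_4 - a_5 + i c_45 = 0]. *)

Set Implicit Arguments.
Unset Strict Implicit.
Unset Printing Implicit Defensive.

Import Order.TTheory GRing.Theory Num.Theory.
Local Open Scope ring_scope.

(** * Sums of squares of polynomials *)

Lemma total_has_least (T : eqType) (le : rel T) (x : T) (s : seq T) :
  total le -> transitive le -> x \in s ->
  exists2 m, m \in s & {in s, forall y, le m y}.
Proof.
move=> tot tr xs; case E: (sort le s) => [|m t].
  by move: xs; rewrite -(mem_sort le) E.
exists m; first by rewrite -(mem_sort le) E mem_head.
move=> y; rewrite -(mem_sort le) E inE => /orP[/eqP ->|yt].
  by have := tot m m; rewrite orbb.
have := sort_sorted tot s; rewrite E /= => /(order_path_min tr) /allP; exact.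
Qed.

Section SumsOfSquares.
Variables (R : realType) (n : nat).
Implicit Types (p q f : {mpoly R[n]}) (ps : seq {mpoly R[n]}).

Lemma sum_of_squares_sqr p : sum_of_squares (p ^+ 2).
Proof. by exists [:: p]; rewrite /sos_representation big_seq1. Qed.

Lemma sum_of_squaresD p q :
  sum_of_squares p -> sum_of_squares q -> sum_of_squares (p + q).
Proof.
by case=> ps -> [qs ->]; exists (ps ++ qs); rewrite /sos_representation big_cat.
Qed.

Lemma sum_of_squaresM p q :
  sum_of_squares p -> sum_of_squares q -> sum_of_squares (p * q).
Proof.
case=> ps -> [qs ->]; exists [seq r * s | r <- ps, s <- qs].
rewrite /sos_representation big_allpairs_dep /= mulr_suml; apply: eq_bigr => r _.
by rewrite mulr_sumr; apply: eq_bigr => s _; rewrite exprMn.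
Qed.

Lemma sum_of_squares_sum (I : Type) (r : seq I) (P : pred I)
    (F : I -> {mpoly R[n]}) :
  (forall i, sum_of_squares (F i)) -> sum_of_squares (\sum_(i <- r | P i) F i).
Proof.
move=> hF; elim/big_ind: _ => [|p q|i _]; last exact: hF.
- by exists [::]; rewrite /sos_representation big_nil.
- exact: sum_of_squaresD.
Qed.

(** A monomial that is the only way of writing its own square as a product of
    two monomials of [p] receives no cross terms in [p ^+ 2]. *)
Lemma sqr_mcoeff_extreme p (m : 'X_{1..n}) :
  {in msupp p &, forall m1 m2, (m1 + m2 = m + m)%MM -> m1 = m} ->
  (p ^+ 2)@_(m + m) = p@_m ^+ 2.
Proof.
move=> ext; rewrite expr2 mpolyME.
have [pm|pm] := boolP (m \in msupp p); last first.
  rewrite (memN_msupp_eq0 pm) expr0n /= raddf_sum big1_seq //=.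
  case=> m1 m2 /allpairsP[[m1' m2'] /= [s1 s2 [-> ->]]].
  rewrite mcoeffZ mcoeffX; have [e|_] := eqVneq; last by rewrite mulr0.
  by have := s1; rewrite (ext _ _ s1 s2 e) (negbTE pm).
rewrite (bigD1_seq (m, m)) /=; first last.
- by rewrite allpairs_uniq // => -[? ?] [].
- by rewrite allpairs_f.
rewrite mcoeffD mcoeffZ mcoeffX eqxx mulr1 raddf_sum big_seq_cond big1 ?addr0 //=.
case=> m1 m2 /andP[/allpairsP[[m1' m2'] /= [s1 s2 [-> ->]]]].
apply: contraNeq; rewrite mcoeffZ mcoeffX.
have [e|_] := eqVneq (m1' + m2')%MM _; last by rewrite mulr0 eqxx.
move=> _; have e1 := ext _ _ s1 s2 e; rewrite e1 in e *.
by move/eqP: e; rewrite eqm_add2l => /eqP ->.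
Qed.

(** The coefficient of the sum of squares at [m + m] is a sum of squares of
    real coefficients, one of them nonzero: nothing cancels, so [m + m] is a
    monomial of [f].  Leaving the order [le] open gives both the largest and the
    smallest monomial occurring in a representation. *)
Lemma sos_mdeg_extreme k ps f (le : rel 'X_{1..n}) (m : 'X_{1..n}) :
  f \is (k + k).-homog -> sos_representation f ps ->
  (forall m1 m2, le m m1 -> le m m2 -> (m1 + m2 = m + m)%MM -> m1 = m) ->
  (forall p, p \in ps -> {in msupp p, forall m', le m m'}) ->
  has (fun p => m \in msupp p) ps -> mdeg m = k.
Proof.
move=> fk fE le_ext mP /hasP[p pps mp].
apply/eqP/negPn/negP => degm.
have /eqP: f@_(m + m) = 0.
  apply: dhomog_nemf_coeff fk _.
  by rewrite /= mdegD !addnn (inj_eq double_inj).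
rewrite fE raddf_sum /= big_seq.
rewrite (eq_bigr (fun q => q@_m ^+ 2)); last first.
  move=> q qps; apply: sqr_mcoeff_extreme => m1 m2 s1 s2.
  by apply: le_ext; apply: (mP q).
rewrite psumr_eq0 => [/allP/(_ p pps)|q _]; last exact: sqr_ge0.
by rewrite pps /= sqrf_eq0 -[_ == 0]negbK -mcoeff_msupp mp.
Qed.

(** In the degree-compatible monomial order, all monomials of the [p]'s lie
    between the smallest and the largest one, and both of these have degree
    [k]. *)
Lemma sos_homog k ps f :
  f \is (k + k).-homog -> sos_representation f ps ->
  forall p, p \in ps -> p \is k.-homog.
Proof.
move=> fk fE p pps; apply/dhomogP => m mp.
pose S := flatten [seq msupp q | q : {mpoly R[n]} <- ps].
have memS q m' : q \in ps -> m' \in msupp q -> m' \in S.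
  by move=> qps mq; apply/flatten_mapP; exists q.
have hasS m' : m' \in S -> has (fun q => m' \in msupp q) ps.
  by move=> /flatten_mapP[q qps mq]; apply/hasP; exists q.
have mS := memS _ _ pps mp.
have le_tot : total (<=%O : rel 'X_{1..n}) by exact: le_total.
have le_tr : transitive (<=%O : rel 'X_{1..n}) by exact: le_trans.
have [u uS uP] := total_has_least le_tot le_tr mS.
have ge_tot : total (>=%O : rel 'X_{1..n}) by move=> a b; apply: le_total.
have ge_tr : transitive (>=%O : rel 'X_{1..n}).
  by move=> a b c ba ac; apply: le_trans ac ba.
have [v vS vP] := total_has_least ge_tot ge_tr mS.
have uk : mdeg u = k.
  apply: (@sos_mdeg_extreme k ps f <=%O u fk fE _ _ (hasS _ uS)) => [m1 m2 h1 h2 e|q qps m' mq].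
    apply/eqP; rewrite eq_le (h1 : (u <= m1)%O) andbT leNgt; apply/negP => h.
    by have := ltmc_le_add h h2; rewrite e ltxx.
  exact/uP/(memS q).
have vk : mdeg v = k.
  apply: (@sos_mdeg_extreme k ps f >=%O v fk fE _ _ (hasS _ vS)) => [m1 m2 h1 h2 e|q qps m' mq].
    apply/eqP; rewrite eq_le (h1 : (m1 <= v)%O) leNgt; apply/negP => h.
    by have := ltmc_le_add h h2; rewrite e ltxx.
  exact/vP/(memS q).
apply/eqP; rewrite eqn_leq /=; apply/andP.
by split; [rewrite -vk | rewrite -uk]; apply: lemc_mdeg; [apply: vP | apply: uP].
Qed.

End SumsOfSquares.

(** * Quadratic forms and their restrictions to planes *)

Section QuadraticForms.
Variables (R : comNzRingType) (n : nat).
Implicit Types (p : {mpoly R[n]}).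

Lemma quadratic_form_matrix p : p \is 2.-homog ->
  exists Q : 'M[R]_n, p = \sum_i \sum_j Q i j *: ('X_i * 'X_j).
Proof.
move=> /dhomogP hp; rewrite [p]mpolyE big_seq.
elim/big_rec: _ => [|m q mp [Q ->]].
  exists 0; rewrite big1 // => i _; rewrite big1 // => j _.
  by rewrite mxE scale0r.
have [i mi] : exists i, m i != 0%N.
  apply/existsP; apply: contraTT isT => /existsPn m0.
  have := hp m mp; rewrite /= mdegE big1 // => i _.
  by apply/eqP; have := m0 i; rewrite negbK.
have Uim : (U_(i) <= m)%MM.
  by apply/mnm_lepP => j; rewrite mnm1E; case: eqP => // <-; rewrite lt0n.
have := hp m mp; rewrite /= -(submK Uim) mdegD mdeg1 addn1 => -[] /eqP.
rewrite mdeg_eq1 => /existsP[j /eqP ->].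
exists (Q + p@_(U_(j) + U_(i)) *: delta_mx j i).
under [RHS]eq_bigr do under eq_bigr do rewrite !mxE scalerDl.
under [RHS]eq_bigr do rewrite big_split.
rewrite big_split addrC; congr (_ + _).
rewrite (bigD1 j) //= (bigD1 i) //= !eqxx mulr1 -mpolyXD.
rewrite !big1 ?addr0 // => [k kj|k ki].
  by rewrite big1 // => l _; rewrite (negbTE kj) mulr0 scale0r.
by rewrite (negbTE ki) andbF mulr0 scale0r.
Qed.

End QuadraticForms.

(** The vector [s e_i + t e_j]; real and complex scalars are both needed. *)
Definition planePoint (S : nzRingType) n (i j : 'I_n) (s t : S) : 'rV[S]_n :=
  s *: delta_mx 0 i + t *: delta_mx 0 j.

Lemma sum_planePoint (S : comNzRingType) n (i j : 'I_n) (s t : S)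
    (F : 'I_n -> S) :
  \sum_k F k * planePoint i j s t 0 k = F i * s + F j * t.
Proof.
under eq_bigr do rewrite !mxE /= mulrDr.
rewrite big_split /= (bigD1 i) //= [X in _ + X](bigD1 j) //= !eqxx !mulr1.
rewrite !big1 ?addr0 // => k kj; by rewrite (negbTE kj) !mulr0.
Qed.

(** The base change [h] lets one formula serve both for the real values that
    enter the functional and for the complex value that has to vanish. *)
Lemma quadratic_form_on_planes (R S : comNzRingType) n (h : {rmorphism R -> S})
    (Q : 'M[R]_n) (i j : 'I_n) (s t : S) :
  (map_mpoly h (\sum_i \sum_j Q i j *: ('X_i * 'X_j))).@[planePoint i j s t 0]
  = h (Q i i) * s ^+ 2 + h (Q j j) * t ^+ 2 + h (Q i j + Q j i) * s * t.
Proof.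
set v := planePoint i j s t.
have -> : (map_mpoly h (\sum_i \sum_j Q i j *: ('X_i * 'X_j))).@[v 0]
    = \sum_k (\sum_l h (Q k l) * v 0 l) * v 0 k.
  rewrite (raddf_sum (map_mpoly h)) (raddf_sum (meval (v 0))).
  apply: eq_bigr => k _.
  rewrite (raddf_sum (map_mpoly h)) (raddf_sum (meval (v 0))) mulr_suml.
  apply: eq_bigr => l _; rewrite /= map_mpolyZ mevalZ rmorphM /= !map_mpolyX.
  by rewrite mevalM !mevalXU -mulrA [v 0 l * _]mulrC.
rewrite sum_planePoint !sum_planePoint rmorphD; ring.
Qed.

(** * The pentagon form *)

Section Pentagon.
Variable (A : comNzRingType).
Definition pentagon (y : nat -> A) : A :=
  (y 0%N - y 1%N + y 2%N - y 3%N) ^+ 2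
  + (y 0%N *+ 3 - y 1%N - y 2%N + y 3%N *+ 3 - y 4%N) ^+ 2
  + y 0%N * y 2%N + y 0%N * y 3%N + y 1%N * y 3%N + y 1%N * y 4%N + y 2%N * y 4%N.

(** The classes of [minn k 4] are four singletons and one block containing all
    indices from 4 on.  That block has at least two elements, which makes room
    for the isotropic vector [e_4 + i e_5], and it absorbs any number of
    further variables. *)
Definition blockNorm n (v : 'I_n -> A) (c : nat) : A :=
  \sum_(k < n | minn k 4 == c) v k ^+ 2.

End Pentagon.

(** At a zero all five products vanish, so for each diagonal one of its two ends
    is 0; each of the resulting cases is a linear problem in which the two linear
    forms force the remaining entries to be 0. *)
Lemma pentagon_gt0 (R : realDomainType) (y : nat -> R) :
  (forall c, 0 <= y c) -> 0 < y 0%N + y 1%N + y 2%N + y 3%N + y 4%N -> 0 < pentagon y.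
Proof.
move=> y0; rewrite /pentagon.
have := (y0 0%N, y0 1%N, y0 2%N, y0 3%N, y0 4%N).
move: (y 0%N) (y 1%N) (y 2%N) (y 3%N) (y 4%N) => a b c d e [[[[ha hb] hc] hd] he] pos.
rewrite lt0r; apply/andP; split; last by rewrite !addr_ge0 ?sqr_ge0 ?mulr_ge0.
apply: contraTneq pos => /eqP; rewrite -leNgt.
rewrite !paddr_eq0 ?addr_ge0 ?sqr_ge0 ?mulr_ge0 //.
rewrite !sqrf_eq0 !mulf_eq0.
case/andP => /andP[/andP[/andP[/andP[/andP[/eqP q1 /eqP q2] ac] ad] bd] be] ce.
by case/orP: ac => /eqP ?; case/orP: ad => /eqP ?; case/orP: bd => /eqP ?;
   case/orP: be => /eqP ?; case/orP: ce => /eqP ?; lra.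
Qed.


Section Form.
Variables (R : realType) (n : nat).

Definition pentagonForm : {mpoly R[n]} :=
  pentagon (blockNorm (fun k => 'X_k)).

Lemma blockNorm_homog c : blockNorm (fun k => 'X_k : {mpoly R[n]}) c \is 2.-homog.
Proof.
by apply: rpred_sum => k _; rewrite -[2%N]/(1 * 2)%N dhomogMn // dhomogX /= mdeg1.
Qed.

Lemma pentagonForm_homog : pentagonForm \is 4.-homog.
Proof.
rewrite /pentagonForm /pentagon -[4%N]/(2 * 2)%N.
have hb := blockNorm_homog.
by do !apply: rpredD; do ?[exact: (@dhomogM _ _ mdeg 2%N _ 2%N)];
   apply: dhomogMn; rewrite !(rpredB, rpredD, rpredMn).
Qed.

Lemma pentagonForm_sos : sum_of_squares pentagonForm.
Proof.
have bsos c : sum_of_squares (blockNorm (fun k => 'X_k : {mpoly R[n]}) c).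
  by apply: sum_of_squares_sum => k; apply: sum_of_squares_sqr.
rewrite /pentagonForm /pentagon.
by do !apply: sum_of_squaresD; first [exact: sum_of_squares_sqr | exact: sum_of_squaresM].
Qed.

Lemma meval_pentagonForm (v : 'I_n -> R) :
  pentagonForm.@[v] = pentagon (blockNorm v).
Proof.
have ev c : (blockNorm (fun k => 'X_k) c).@[v] = blockNorm v c.
  rewrite (raddf_sum (meval v)); apply: eq_bigr => k _.
  by rewrite /= rmorphXn /= mevalXU.
by rewrite /pentagonForm /pentagon !expr2 !(mevalD, mevalM, mevalN, mevalMn) !ev.
Qed.

Lemma pentagonForm_posdef : positive_definite pentagonForm.
Proof.
move=> a a0; rewrite meval_pentagonForm; apply: pentagon_gt0 => [c|].
  by apply: sumr_ge0 => k _; apply: sqr_ge0.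
have [k ak] : exists k, a 0 k != 0.
  apply/existsP; apply: contraNT a0 => /existsPn ak.
  by apply/eqP/rowP => k; rewrite mxE; apply/eqP; have := ak k; rewrite negbK.
have b0 c : 0 <= blockNorm (a 0) c by apply: sumr_ge0 => j _; apply: sqr_ge0.
have : 0 < blockNorm (a 0) (minn k 4).
  rewrite /blockNorm (bigD1 k) //= ltr_wpDr ?exprn_even_gt0 //.
  by apply: sumr_ge0 => j _; apply: sqr_ge0.
have := (b0 0%N, b0 1%N, b0 2%N, b0 3%N, b0 4%N) => -[[[[h0 h1] h2] h3] h4].
have : (minn k 4 <= 4)%N by rewrite geq_minr.
by move: (minn k 4) => [|[|[|[|[|//]]]]] _ h; lra.
Qed.

(** * A functional certifying the common complex zero *)

Variable e : nat -> 'I_n.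
Hypothesis eE : forall i, (i < 6)%N -> e i = i :> nat.

(** Summing over both signs removes the monomials [x_i^3 x_j] and [x_i x_j^3] of a
    quartic [g]. *)
Definition pairValue (g : 'rV[R]_n -> R) i j : R :=
  g (planePoint (e i) (e j) 1 1) + g (planePoint (e i) (e j) 1 (-1)).

Definition vertexValue (g : 'rV[R]_n -> R) i : R :=
  g (planePoint (e i) (e i.+1) 1 0).

(** On quartic forms this is twice the functional that sends [x_i^2 x_j^2] to
    [D i j] and every other monomial to 0: monomials in three or more variables
    vanish at all the points used, each edge [ij] of the pentagon contributes
    [pairValue g i j] with weight [D i j], and the weights at the vertices correct
    the coefficients of the fourth powers to twice the diagonal 1, 2, 2, 1, 4, 4
    of [D].  In terms of point values, linearity and evaluation at squares are
    immediate. *)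
Definition dualFunctional (g : 'rV[R]_n -> R) : R :=
  pairValue g 0%N 1%N + pairValue g 1%N 2%N + pairValue g 2%N 3%N + pairValue g 3%N 4%N
  + pairValue g 3%N 5%N + pairValue g 0%N 4%N + pairValue g 0%N 5%N + pairValue g 4%N 5%N *+ 2
  - vertexValue g 0%N *+ 4 - vertexValue g 3%N *+ 4.

Lemma dualFunctional_sum (ps : seq {mpoly R[n]}) :
  dualFunctional (fun v => (\sum_(p <- ps) p ^+ 2).@[v 0])
  = \sum_(p <- ps) dualFunctional (fun v => p.@[v 0] ^+ 2).
Proof.
have evE (v : 'rV[R]_n) :
    (\sum_(p <- ps) p ^+ 2).@[v 0] = \sum_(p <- ps) p.@[v 0] ^+ 2.
  by rewrite raddf_sum; apply: eq_bigr => p _; rewrite /= rmorphXn.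
rewrite /dualFunctional /pairValue /vertexValue !evE.
by rewrite !(big_split, sumrN, sumrMnl).
Qed.

Lemma blockNorm_planePoint (i j : 'I_n) (s t : R) c : i != j ->
  blockNorm (planePoint i j s t 0) c
  = s ^+ 2 *+ (minn i 4 == c) + t ^+ 2 *+ (minn j 4 == c).
Proof.
move=> ij; rewrite /blockNorm big_mkcond /= (bigD1 i) //= (bigD1 j) 1?eq_sym //=.
rewrite big1 ?addr0 => [|k /andP[ki kj]].
  rewrite !mxE !eqxx (negbTE ij) [j == i]eq_sym (negbTE ij) /=.
  by rewrite !mulr1 !mulr0 addr0 add0r; do 2!case: eqP.
by rewrite !mxE (negbTE ki) (negbTE kj) !mulr0 addr0 expr0n; case: ifP.
Qed.

Lemma e_neq i j : (i < j < 6)%N -> e i != e j.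
Proof.
move=> /andP[ij j6]; rewrite -val_eqE /= !eE //; last exact: ltn_trans j6.
by rewrite neq_ltn ij.
Qed.

Lemma dualFunctional_pentagonForm :
  dualFunctional (fun v => pentagonForm.@[v 0]) = 0.
Proof.
have bE i j (s t : R) c : (i < j < 6)%N ->
    blockNorm (planePoint (e i) (e j) s t 0) c
    = s ^+ 2 *+ (minn i 4 == c) + t ^+ 2 *+ (minn j 4 == c).
  move=> /[dup] ij /andP[lij j6]; rewrite blockNorm_planePoint ?e_neq //.
  by rewrite !eE //; exact: ltn_trans j6.
rewrite /dualFunctional /pairValue /vertexValue !meval_pentagonForm /pentagon.
rewrite !bE //= /minn /=; ring.
Qed.

(** The value at [p ^+ 2] is twice the quadratic form of [D] at the pure
    coefficients of [p] plus the mixed coefficients squared with nonnegative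
    weights.  The two squares kept on the left are those that determine the value
    of [p] at [e_4 + i e_5]. *)
Lemma dualFunctional_sqr (Q : 'M[R]_n) (p : {mpoly R[n]}) :
  p = \sum_i \sum_j Q i j *: ('X_i * 'X_j) ->
  (Q (e 4%N) (e 4%N) - Q (e 5%N) (e 5%N)) ^+ 2
  + (Q (e 4%N) (e 5%N) + Q (e 5%N) (e 4%N)) ^+ 2
  <= dualFunctional (fun v => p.@[v 0] ^+ 2).
Proof.
move=> pE.
have pv i j (s t : R) : p.@[planePoint (e i) (e j) s t 0]
    = Q (e i) (e i) * s ^+ 2 + Q (e j) (e j) * t ^+ 2
      + (Q (e i) (e j) + Q (e j) (e i)) * s * t.
  have {1}<- : map_mpoly idfun p = p.
    by apply/mpolyP => m; apply: mcoeff_map_mpoly.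
  by rewrite {1}pE quadratic_form_on_planes.
rewrite /dualFunctional /pairValue /vertexValue !pv.
set a := fun i => Q (e i) (e i); set c := fun i j => Q (e i) (e j) + Q (e j) (e i).
rewrite -!/(a _) -!/(c _ _) -subr_ge0.
set d := (X in 0 <= X).
have -> : d = (a 0%N + a 1%N + a 4%N + a 5%N) ^+ 2 *+ 2
  + (a 1%N + a 2%N - a 4%N - a 5%N) ^+ 2 *+ 2
  + (a 2%N + a 3%N + a 4%N + a 5%N) ^+ 2 *+ 2
  + (a 4%N - a 5%N) ^+ 2
  + (c 0%N 1%N ^+ 2 + c 1%N 2%N ^+ 2 + c 2%N 3%N ^+ 2 + c 3%N 4%N ^+ 2
     + c 3%N 5%N ^+ 2 + c 0%N 4%N ^+ 2 + c 0%N 5%N ^+ 2) *+ 2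
  + c 4%N 5%N ^+ 2 *+ 3.
  rewrite /d; ring.
by rewrite !(addr_ge0, mulrn_wge0, sqr_ge0).
Qed.

Lemma pentagonForm_noncoercive : noncoercive pentagonForm.
Proof.
split=> [|ps psE]; first exact: pentagonForm_sos.
have hom2 := @sos_homog R n 2 ps pentagonForm pentagonForm_homog psE.
exists (planePoint (e 4%N) (e 5%N) 1 'i%C) => [|p pps].
  apply/eqP => /rowP /(_ (e 4%N)); rewrite !mxE !eqxx (negbTE (@e_neq 4 5 _)) //.
  by rewrite mulr1 mulr0 addr0 => /eqP; rewrite oner_eq0.
have dual_ge0 q : q \in ps -> 0 <= dualFunctional (fun v => q.@[v 0] ^+ 2).
  move=> qps; have [Q QE] := quadratic_form_matrix (hom2 _ qps).
  by apply: le_trans (dualFunctional_sqr QE); rewrite addr_ge0 ?sqr_ge0.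
have /eqP : dualFunctional (fun v => p.@[v 0] ^+ 2) = 0.
  have /eqP := dualFunctional_pentagonForm.
  rewrite psE dualFunctional_sum big_seq psumr_eq0 //.
  by move=> /allP/(_ p pps); rewrite pps => /eqP.
have [Q QE] := quadratic_form_matrix (hom2 _ pps).
move=> /eqP d0; have := dualFunctional_sqr QE; rewrite d0 => le0.
have /andP[/eqP h1 /eqP h2] : ((Q (e 4%N) (e 4%N) - Q (e 5%N) (e 5%N)) ^+ 2 == 0)
    && ((Q (e 4%N) (e 5%N) + Q (e 5%N) (e 4%N)) ^+ 2 == 0).
  by rewrite -paddr_eq0 ?sqr_ge0 // eq_le le0 addr_ge0 ?sqr_ge0.
move/eqP: h1; move/eqP: h2; rewrite !sqrf_eq0 subr_eq0 => /eqP h2 /eqP h1.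
rewrite QE quadratic_form_on_planes h1 h2 sqr_i; ring.
Qed.

End Form.

Theorem theorem1p4 (R : realType) (n : nat) (hn : (6 <= n)%N) :
  exists f : {mpoly R[n]},
    [/\ Sigma 4 f, positive_definite f & noncoercive f].
Proof.
case: n hn => // n hn; exists (pentagonForm R n.+1); split.
- by split; [apply: pentagonForm_homog | apply: pentagonForm_sos].
- exact: pentagonForm_posdef.
- apply: (@pentagonForm_noncoercive R n.+1 inord) => i i6.
  by rewrite inordK // (leq_trans i6).
Qed.
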